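(* Let $\mathcal A\colon\mathcal X\to\mathcal X'$ be Fréchet differentiable, strongly monotone (constant $\alpha$), locally Lipschitz continuous (constants $L[\vartheta]$), with uniformly coercive derivative (constant $\beta$) and locally Lipschitz continuous derivative (constants $M[\vartheta]$). Let $F\in\mathcal X'$, let $\mathcal X_H\subseteq\mathcal X$ be a closed subspace, and let the initial iterate $u_H^0\in\mathcal X_H$ satisfy $\|u_H^0\|_{\mathcal X}\le c_0B_0$ for some constant $c_0>1$, where $B_0:=\alpha^{-1}\|F-\mathcal A0\|_{\mathcal X'}$. With $\overline B_0:=\alpha^{-1}L[(1+c_0)B_0]\,(1+c_0)B_0+B_0$, abbreviate $$C_0:=\frac{M[\overline B_0]\,L[(1+c_0)B_0]\,(1+c_0)B_0}{2\beta^2}\le\frac{\alpha\,M[\overline B_0]\,\overline B_0}{2\beta^2}.$$ Then, for all $0<\delta\le1$ and all $v_H\in\mathcal L_H[u_H^0]$, $$\|F-\mathcal A(\Phi(\delta;v_H))\|_{\mathcal X_H'}<\big[1-\delta+C_0\,\delta^2\big]\,\|F-\mathcal A v_H\|_{\mathcal X_H'} .$$ The choice of the optimal damping parameter $\delta=\delta_{\rm opt}:=\min\{(2C_0)^{-1},1\}$ for the quadratic function $r\colon(0,1]\to\mathbb R$ with $r[\delta]:=1-\delta+C_0\,\delta^2$ ensures the optimal reduction constant $0<r_{\rm opt}[\delta_{\rm opt}]<1$ such that, for $\delta=\delta_{\rm opt}$ and all $v_H\in\mathcal L_H[u_H^0]$, $$\|F-\mathcal A(\Phi(\delta;v_H))\|_{\mathcal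 X_H'}<r_{\rm opt}[\delta_{\rm opt}]\,\|F-\mathcal A v_H\|_{\mathcal X_H'}\quad\text{with}\quad r_{\rm opt}[\delta_{\rm opt}]=\begin{cases}1-\dfrac{\delta_{\rm opt}}{2}&\text{if }\delta_{\rm opt}<1,\\ C_0&\text{else.}\end{cases}$$ Moreover, any $0<\delta\le\delta_{\rm opt}$ leads to a reduction factor $r[\delta]$ satisfying $1-\delta_{\rm opt}/2\le r[\delta]<1$ such that, for $v_H\in\mathcal L_H[u_H^0]$, the Newton iterate $\Phi(\delta;v_H)\in\mathcal L_H[u_H^0]$ remains within the same level set.
   Context: $\mathcal X$ is a Hilbert space with norm $\|\cdot\|_{\mathcal X}$ induced by its inner product, $\mathcal X'$ is its topological dual with dual norm $\|\cdot\|_{\mathcal X'}$, and $\langle\cdot,\cdot\rangle$ is the duality pairing on $\mathcal X'\times\mathcal X$. For a closed subspace $\mathcal X_H\subseteq\mathcal X$ and $\phi\in\mathcal X'$, $\|\phi\|_{\mathcal X_H'}:=\sup\{\langle\phi,w_H\rangle: w_H\in\mathcal X_H,\ \|w_H\|_{\mathcal X}=1\}$. The Fréchet derivative of $\mathcal A$ at $v\in\mathcal X$ is $\mathrm d\mathcal A[v]\in\mathcal L(\mathcal X,\mathcal X')$ (bounded linear operators with the operator norm). Assumptions: - Strong monotonicity: there is $\alpha>0$ with $\alpha\|v-w\|_{\mathcal X}^2\le\langle\mathcal A v-\mathcal A w,v-w\rangle$ for all $v,w\in\mathcal X$. - Local Lipschitz continuity: for all $\vartheta>0$ there is $L[\vartheta]>0$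 with $\langle\mathcal A v-\mathcal A w,\varphi\rangle\le L[\vartheta]\,\|v-w\|_{\mathcal X}\|\varphi\|_{\mathcal X}$ for all $v,w,\varphi\in\mathcal X$ with $\max\{\|v\|_{\mathcal X},\|v-w\|_{\mathcal X}\}\le\vartheta$. - Uniform coercivity (strong monotonicity) of the derivative: there is $\beta>0$ with $\beta\|w\|_{\mathcal X}^2\le\langle\mathrm d\mathcal A[v]w,w\rangle$ for all $v,w\in\mathcal X$. - Local Lipschitz continuity of the derivative: for all $\vartheta>0$ there is $M[\vartheta]>0$ with $\|\mathrm d\mathcal A[v]-\mathrm d\mathcal A[w]\|_{\mathcal L(\mathcal X,\mathcal X')}\le M[\vartheta]\,\|v-w\|_{\mathcal X}$ for all $v,w\in\mathcal X$ with $\max\{\|v\|_{\mathcal X},\|v-w\|_{\mathcal X}\}\le\vartheta$; $M[\cdot]$ is monotone and uniformly bounded from below, i.e., $0\le\vartheta_1\le\vartheta_2$ implies $0<M[0]\le M[\vartheta_1]\le M[\vartheta_2]$. - Standing assumption: $\mathcal A0\ne F$, so $B_0>0$. Level set: $\mathcal L_H[u_H^0]:=\{v_H\in\mathcal X_H:\|F-\mathcal A v_H\|_{\mathcal X_H'}<\|F-\mathcal A u_H^0\|_{\mathcal X_H'}\}$. Damped Newton step: for $v_H\in\mathcal X_H$ and $0<\delta\le1$, $\Phi(\delta;v_H):=v_H+\delta\varrho_H$, where $\varrho_H\in\mathcal X_H$ is the unique solution of $\langle\mathrm d\mathcal A[v_H]\varrho_H,w_H\rangle=\langle F-\mathcal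 A v_H,w_H\rangle$ for all $w_H\in\mathcal X_H$.
   Formalization: The strict residual reductions are proved when the residual of v_H is nonzero (≤ otherwise, both sides being 0); the bound 1−δ_opt/2 ≤ r[δ] is proved for C_0 ≥ 1/2 and replaced by r_opt ≤ r[δ] in general, since it fails at δ=1 if C_0 < 1/2. *)

(* Defs.v *)
From HB Require Import structures.
From mathcomp Require Import all_boot all_order all_algebra.
From mathcomp Require Import all_classical all_reals all_analysis.

Set Implicit Arguments.
Unset Strict Implicit.
Unset Printing Implicit Defensive.

Import Order.TTheory GRing.Theory Num.Theory.
Import numFieldNormedType.Exports.

Local Open Scope classical_set_scope.
Local Open Scope ring_scope.

Section OperatorNorm.
Context {R : realType} {V W : normedModType R}.

(* Meaningful only for bounded linear [f]: [sup] is 0 on an unbounded set.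
   It is also 0 on the empty set, which is the right value when [V] = {0}. *)
Definition opnorm (f : V -> W) : R := sup [set `|f x| | x in [set x | `|x| = 1]].

Lemma opnorm_has_ubound (f : V -> W) : linear f -> continuous f ->
  has_ubound [set `|f x| | x in [set x | `|x| = 1]].
Proof.
move=> lf cf; pose g : {linear V -> W} :=
  HB.pack f (GRing.isLinear.Build _ _ _ _ _ lf).
have cg0 : {for 0, continuous g} by exact: cf.
have [M gM] := (bounded_funP g).2 (continuous_linear_bounded 0 cg0) 1.
by exists M => _ [x /= x1 <-]; apply: gM; rewrite x1.
Qed.

Lemma opnormP (f : V -> W) : linear f -> continuous f ->
  forall x, `|f x| <= opnorm f * `|x|.
Proof.
move=> lf cf x; have ub := opnorm_has_ubound lf cf.
pose g : {linear V -> W} :=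
  HB.pack f (GRing.isLinear.Build _ _ _ _ _ lf).
have [->|x0] := eqVneq x 0; first by rewrite [f 0](linear0 g) !normr0 mulr0.
have nx : 0 < `|x| by rewrite normr_gt0.
rewrite -ler_pdivrMr//; apply: sup_ubound => //.
exists (`|x|^-1 *: x); first by rewrite /= normrZ normfV normr_id mulVf ?gt_eqF.
have -> : f (`|x|^-1 *: x) = `|x|^-1 *: f x by exact: (linearZ_LR g).
by rewrite normrZ normfV normr_id mulrC.
Qed.

Lemma opnorm_ge0 (f : V -> W) : 0 <= opnorm f.
Proof.
rewrite /opnorm; set S := (X in sup X).
have [hS|/sup_out ->//] := pselect (has_sup S).
have [[y Sy] _] := hS; have [x _ xy] := Sy.
by rewrite (le_trans (normr_ge0 (f x)))// xy sup_upper_bound.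
Qed.

Lemma opnorm_le (f : V -> W) (c : R) : 0 <= c ->
  (forall x, `|x| = 1 -> `|f x| <= c) -> opnorm f <= c.
Proof.
move=> c0 fc; rewrite /opnorm; set S := (X in sup X).
have [->|/set0P S0] := eqVneq S set0; first by rewrite sup0.
by apply: ge_sup => // _ [x /= x1 <-]; exact: fc.
Qed.

End OperatorNorm.

Section Dual.
Context (R : realType) (X : normedModType R).

Definition continuous_linear_form : {pred X -> R^o} :=
  [pred f | `[< linear f /\ continuous f >]].

Lemma continuous_linear_form_submod_closed : submod_closed continuous_linear_form.
Proof.
split=> [|a f g]; rewrite !inE.
  split=> [k u v|x]; first by rewrite /GRing.zero/= scaler0 addr0.
  exact: cvg_cst.
move=> [lf cf] [lg cg]; split.
  move=> k u v; rewrite !fctE lf lg !scalerDr !scalerA (mulrC a k) -!addrA.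
  by congr +%R; rewrite addrCA.
move=> x; apply: (@continuousD _ _ _ (a \*: f) g); last exact: cg.
by apply: continuousZl_tmp; exact: cf.
Qed.

HB.instance Definition _ := GRing.isSubmodClosed.Build _ _ continuous_linear_form
  continuous_linear_form_submod_closed.

(* The topological dual X', normed by [opnorm]; the duality pairing
   <phi, x> is the application [phi x]. *)
Record dual := Dual {
  dual_fun :> X -> R ;
  _ : (dual_fun : X -> R^o) \in continuous_linear_form }.

HB.instance Definition _ := [isSub for dual_fun].
HB.instance Definition _ := [Choice of dual by <:].
HB.instance Definition _ := [SubChoice_isSubLmodule of dual by <:].

Lemma dual_linear (f : dual) : linear (f : X -> R^o).
Proof. by case: f => f /= /asboolP[]. Qed.

Lemma dual_continuous (f : dual) : continuous (f : X -> R^o).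
Proof. by case: f => f /= /asboolP[]. Qed.

HB.instance Definition _ (f : dual) :=
  GRing.isLinear.Build R X R^o _ (dual_fun f) (dual_linear f).

Let dual_norm (f : dual) : R := opnorm (f : X -> R^o).

Let dual_normD f g : dual_norm (f + g) <= dual_norm f + dual_norm g.
Proof.
apply: opnorm_le => [|x x1]; first by rewrite addr_ge0// opnorm_ge0.
rewrite (le_trans (ler_normD _ _))// lerD//.
  by rewrite -[leRHS]mulr1 -x1; apply: opnormP;
    [exact: dual_linear|exact: dual_continuous].
by rewrite -[leRHS]mulr1 -x1; apply: opnormP;
    [exact: dual_linear|exact: dual_continuous].
Qed.

Let dual_normZ (a : R) f : dual_norm (a *: f) = `|a| * dual_norm f.
Proof.
have leZ b g : dual_norm (b *: g) <= `|b| * dual_norm g.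
  apply: opnorm_le => [|x x1]; first by rewrite mulr_ge0// opnorm_ge0.
  rewrite (_ : `|_| = `|b| * `|g x|); last exact: normrM.
  rewrite ler_wpM2l// -[leRHS]mulr1 -x1.
  by apply: opnormP; [exact: dual_linear|exact: dual_continuous].
apply/eqP; rewrite eq_le leZ/=.
have [->|a0] := eqVneq a 0; first by rewrite normr0 mul0r opnorm_ge0.
rewrite -ler_pdivlMl ?normr_gt0// -normfV.
by rewrite -{1}[f]scale1r -(mulVf a0) -scalerA leZ.
Qed.

Let dual_norm0 f : dual_norm f = 0 -> f = 0.
Proof.
move=> f0; apply/val_inj/funext => x; apply/normr0_eq0/eqP.
rewrite eq_le normr_ge0 andbT -[leRHS](mul0r `|x|) -f0.
by apply: (@opnormP _ _ R^o); [exact: dual_linear|exact: dual_continuous].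
Qed.

HB.instance Definition _ := @Lmodule_isNormed.Build R dual dual_norm
  dual_normD dual_normZ dual_norm0.

Lemma dual_normE (f : dual) : `|f| = opnorm (f : X -> R^o).
Proof. by []. Qed.

End Dual.

Section Operators.
Context {R : realType} {X : normedModType R} (A : X -> dual X).

Definition strongly_monotone (alpha : R) : Prop :=
  forall v w : X, alpha * `|v - w| ^+ 2 <= (A v - A w) (v - w).

Definition locally_lipschitz (L : R -> R) : Prop :=
  forall theta, 0 < theta -> 0 < L theta /\
    forall v w phi : X, Num.max `|v| `|v - w| <= theta ->
      (A v - A w) phi <= L theta * `|v - w| * `|phi|.

Definition uniformly_coercive_derivative (beta : R) : Prop :=
  forall v w : X, beta * `|w| ^+ 2 <= 'd A v w w.

Definition locally_lipschitz_derivative (M : R -> R) : Prop :=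
  (forall theta, 0 < theta -> 0 < M theta /\
    forall v w : X, Num.max `|v| `|v - w| <= theta ->
      opnorm (fun x => 'd A v x - 'd A w x) <= M theta * `|v - w|) /\
  (forall theta1 theta2, 0 <= theta1 -> theta1 <= theta2 ->
    [/\ 0 < M 0, M 0 <= M theta1 & M theta1 <= M theta2]).

End Operators.

Section Galerkin.
Context {R : realType} {X : normedModType R}.
Variables (A : X -> dual X) (F : dual X) (XH : submodClosed X).

Definition subdual_norm (phi : dual X) : R :=
  sup [set phi w | w in [set w : X | w \in XH /\ `|w| = 1]].

Definition residual (v : X) : R := subdual_norm (F - A v).

Definition level_set (u0 : X) : set X :=
  [set v | v \in XH /\ residual v < residual u0].

(* [get] selects the unique solution of the linearized problem, which exists
   when ['d A v] is bounded and coercive and [XH] is closed. *)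
Definition newton_direction (v : X) : X :=
  get [set rho | rho \in XH /\ forall w, w \in XH -> 'd A v rho w = (F - A v) w].

Definition newton_step (delta : R) (v : X) : X := v + delta *: newton_direction v.

End Galerkin.

(* Main.v *)
Require Import Defs.
From mathcomp Require Import all_boot all_order all_algebra.
From mathcomp Require Import all_classical all_reals all_analysis.
From mathcomp Require Import ring lra.

Set Implicit Arguments.
Unset Strict Implicit.
Unset Printing Implicit Defensive.

Import Order.TTheory GRing.Theory Num.Theory.
Import numFieldNormedType.Exports.

Local Open Scope classical_set_scope.
Local Open Scope ring_scope.

(** A damped Newton step removes the fraction [delta] of the residual, up to a
first-order Taylor remainder. Tested with [w] in [XH], the linearized equation
for the direction [rho] gives
  <F - A (v + delta rho), w> = (1 - delta) <F - A v, w> + remainder,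
and the Lipschitz bound [M] on the derivative along the segment from [v] to
[v + delta rho] bounds the remainder by [M |rho|^2 |w| delta^2 / 2]
([taylor_remainder], [residual_newton_step]). Coercivity of the derivative gives
[beta |rho| <= res v], so the remainder is quadratic in [res v]; one factor
[res v] is absorbed in [C0] because [res v < res u0] on the level set and
[res u0] is at most [l0 := L0 (1 + c0) B0], whence [C0 = M l0 / (2 beta^2)].

Three a priori bounds locate the level set by means of the exact Galerkin
solution [u] in [XH]: [|u| <= B0]; [alpha |v - u| <= res v]; and
[res u0 <= l0], as [u] and [u - u0] lie in the ball of radius [(1 + c0) B0].
Together they place [v] in the ball of radius [Bbar0]. The direction [rho] has
to lie in that ball too, since the local Lipschitz constant of the derivative is
taken there; this uses [alpha |rho| <= res v], and not the constant [beta], which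
may be smaller than [alpha]. It is available because strong monotonicity of [A]
passes to difference quotients and hence to the derivative
([strongly_monotone_derivative]).

Existence of [u] and of [rho] comes from a single result,
[galerkin_solution], applied to [A] and to its derivative at [v]. Riesz
representation on [XH] turns the equation into a fixed point problem
[v = v + tau J (F - A v)], and for [tau] small the map is a contraction of a ball
large enough to be mapped into itself, so that a Lipschitz constant on that ball
suffices.

What remains concerns the real parabola [1 - delta + C0 delta^2]
([optimal_damping]). *)

(** * Duality pairing and the norm of a functional on a subspace *)

Section Duality.
Context {R : realType} {X : normedModType R}.
Implicit Types (phi psi : dual X) (x : X).

Lemma dualB phi psi x : (phi - psi) x = phi x - psi x.
Proof. by []. Qed.

Lemma dualZ (a : R) phi x : (a *: phi) x = a * phi x.
Proof. by []. Qed.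

Lemma submodN (XH : submodClosed X) x : x \in XH -> - x \in XH.
Proof. by move=> xXH; rewrite -scaleN1r rpredZ. Qed.

Lemma submodB (XH : submodClosed X) x y : x \in XH -> y \in XH -> x - y \in XH.
Proof. by move=> xXH yXH; rewrite rpredD// submodN. Qed.

Lemma dualZr phi (a : R) x : phi (a *: x) = a * phi x.
Proof. exact: (linearZ_LR phi). Qed.

Lemma dualNr phi x : phi (- x) = - phi x.
Proof. exact: (raddfN phi). Qed.

Lemma dualDr phi x y : phi (x + y) = phi x + phi y.
Proof. exact: (raddfD phi). Qed.

Lemma dual_le phi x : `|phi x| <= `|phi| * `|x|.
Proof.
by apply: (@opnormP _ _ R^o); [exact: dual_linear|exact: dual_continuous].
Qed.

Lemma subdual_has_ubound (XH : submodClosed X) phi :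
  has_ubound [set phi w | w in [set w : X | w \in XH /\ `|w| = 1]].
Proof.
exists `|phi| => _ [w [_ w1] <-].
by rewrite (le_trans (ler_norm _))// (le_trans (dual_le _ _))// w1 mulr1.
Qed.

Lemma subdual_normP (XH : submodClosed X) phi w : w \in XH ->
  phi w <= subdual_norm XH phi * `|w|.
Proof.
move=> wXH; have [->|w0] := eqVneq w 0.
  by rewrite normr0 mulr0 (raddf0 phi).
have nw : 0 < `|w| by rewrite normr_gt0.
rewrite -ler_pdivrMr//; apply: sup_ubound; first exact: subdual_has_ubound.
exists (`|w|^-1 *: w).
  by split; [rewrite rpredZ|rewrite normrZ normfV normr_id mulVf// gt_eqF].
by rewrite dualZr mulrC.
Qed.

(** The unit vectors of [XH] come in pairs [w], [- w], on which a functional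
takes opposite values; when [XH] is trivial, the supremum of the empty set
is 0. *)
Lemma subdual_norm_ge0 (XH : submodClosed X) phi : 0 <= subdual_norm XH phi.
Proof.
rewrite /subdual_norm; set S := (X in sup X).
have [->|/set0P[_ [w [wXH w1] _]]] := eqVneq S set0; first by rewrite sup0.
have := subdual_normP phi wXH; have := subdual_normP phi (submodN wXH).
rewrite dualNr normrN w1 mulr1 /subdual_norm -/S; lra.
Qed.

Lemma subdual_norm_le (XH : submodClosed X) phi c : 0 <= c ->
  (forall w, w \in XH -> phi w <= c * `|w|) -> subdual_norm XH phi <= c.
Proof.
move=> c0 phic; rewrite /subdual_norm.
set S := (X in sup X); have [->|/set0P S0] := eqVneq S set0; first by rewrite sup0.
by apply: ge_sup => // _ [x [xXH x1] <-]; rewrite -[c]mulr1 -x1; exact: phic.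
Qed.

End Duality.

(** * Riesz representation on a closed subspace *)

Section Hilbert.
Context {R : realType} {X : completeNormedModType R} (dot : {dot X for idfun}).
Context (dotE : forall x : X, `|x| = Num.sqrt (dot x x)).
Context (XH : submodClosed X) (XH_closed : closed [set` XH]).

Lemma dotC u v : dot u v = dot v u.
Proof. by rewrite (hermC dot) expr0 mul1r. Qed.

Lemma dotxx u : dot u u = `|u| ^+ 2.
Proof.
rewrite dotE sqr_sqrtr//; have [->|/neq0_dnorm_gt0/ltW//] := eqVneq u 0.
by rewrite linear0l.
Qed.

Lemma dotDl u v w : dot (u + v) w = dot u w + dot v w.
Proof. exact: linearDl. Qed.

Lemma dotZl a u w : dot (a *: u) w = a * dot u w.
Proof. exact: linearZl_LR. Qed.

Lemma dotBl u v w : dot (u - v) w = dot u w - dot v w.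
Proof. exact: linearBl. Qed.

Lemma dotDr u v w : dot w (u + v) = dot w u + dot w v.
Proof. by rewrite dotC dotDl !(dotC w). Qed.

Lemma dotZr a u w : dot w (a *: u) = a * dot w u.
Proof. by rewrite dotC dotZl (dotC w). Qed.

Lemma sqr_normD_scale (a : R) u v :
  `|u + a *: v| ^+ 2 = `|u| ^+ 2 + 2 * a * dot u v + a ^+ 2 * `|v| ^+ 2.
Proof.
by rewrite -!dotxx dotDl !dotDr !dotZl !dotZr (dotC v u); ring.
Qed.

(** The Riesz representative of [phi] on [XH] is the minimizer of this
functional. *)
Let energy (phi : dual X) (w : X) : R := `|w| ^+ 2 / 2 - phi w.

(** The parallelogram law: two points of nearly minimal energy are close,
since their midpoint cannot do much better. *)
Let energy_gap phi a b : energy phi a + energy phi b =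
  2 * energy phi (2^-1 *: (a + b)) + `|a - b| ^+ 2 / 4.
Proof.
have eD : `|a + b| ^+ 2 = `|a| ^+ 2 + 2 * dot a b + `|b| ^+ 2.
  by rewrite -[b in LHS]scale1r sqr_normD_scale; ring.
have eB : `|a - b| ^+ 2 = `|a| ^+ 2 - 2 * dot a b + `|b| ^+ 2.
  by rewrite -scaleN1r sqr_normD_scale; ring.
rewrite /energy dualZr dualDr normrZ exprMn ger0_norm ?invr_ge0// eD eB.
by field.
Qed.

(** By [energy_gap] a minimizing sequence is Cauchy; its limit stays in the
closed subspace and minimizes by continuity. *)
Let energy_minimizer (phi : dual X) :
  exists2 g, g \in XH & forall w, w \in XH -> energy phi g <= energy phi w.
Proof.
pose S := [set energy phi w | w in [set` XH]].
have S0 : has_inf S.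
  split; first by exists (energy phi 0), 0 => //=; exact: rpred0.
  exists (- (`|phi| ^+ 2 / 2)) => _ [w _ <-].
  have := le_trans (ler_norm _) (dual_le phi w); rewrite /energy.
  have := sqr_ge0 (`|phi| - `|w|); lra.
have low w : w \in XH -> inf S <= energy phi w.
  by move=> wXH; apply: ge_inf; [case: S0|exists w].
have /choice[w wP] (n : nat) : exists w, w \in XH /\
    energy phi w < inf S + n.+1%:R^-1.
  have n0 : 0 < n.+1%:R^-1 :> R by rewrite invr_gt0.
  by have [_ [w wXH <-] ?] := inf_adherent n0 S0; exists w.
have dist n m : `|w n - w m| ^+ 2 <= 4 * (n.+1%:R^-1 + m.+1%:R^-1).
  have [wn en] := wP n; have [wm em] := wP m.
  have := low (2^-1 *: (w n + w m)).
  rewrite rpredZ ?rpredD// => /(_ isT) lownm.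
  have gap := energy_gap phi (w n) (w m).
  move: en em lownm gap.
  move: (energy _ _) (energy _ _) (energy _ _) (n.+1%:R^-1) (m.+1%:R^-1) (inf S).
  move=> a b c i j s; lra.
have w_cvg : cvgn w.
  apply/cauchy_cvgP/cauchy_ballP => e e0; near_simpl.
  have e2 : 0 < e ^+ 2 / 8 by rewrite divr_gt0// exprn_gt0.
  near=> x y => /=; rewrite -ball_normE/= -(ltr_pXn2r (n := 2))// ?nnegrE ?(ltW e0)//.
  apply: le_lt_trans (dist _ _) _.
  have small (s t c : R) : s < c / 8 -> t < c / 8 -> 4 * (s + t) < c.
    by move=> *; lra.
  apply: small; [near: x|near: y]; exact: near_infty_natSinv_lt (PosNum e2).
exists (limn w).
  apply: (closed_cvg [set` XH]) w_cvg => //.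
  by apply: nearW => n; case: (wP n).
move=> v vXH; apply: le_trans (low v vXH).
have e_cvg : energy phi (w n) @[n --> \oo] --> energy phi (limn w).
  apply: cvgB; last first.
    have phic : {for limn w, continuous (phi : X -> R^o)} by exact: dual_continuous.
    exact: (cvg_comp w phi w_cvg phic).
  apply: cvgM; last exact: cvg_cst.
  by apply: cvgM; exact: cvg_norm.
have b_cvg : inf S + n.+1%:R^-1 @[n --> \oo] --> inf S + 0.
  by apply: cvgD; [exact: cvg_cst|exact: cvg_harmonic].
rewrite -[leRHS]addr0; apply: (ler_cvg_to e_cvg b_cvg).
by apply: nearW => n; case: (wP n) => _ /ltW.
Unshelve. all: by end_near. Qed.

Lemma riesz_representation (phi : dual X) :
  exists2 g, g \in XH & forall w, w \in XH -> dot g w = phi w.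
Proof.
have [g gXH gmin] := energy_minimizer phi; exists g => // w wXH.
set c := dot g w - phi w.
have var t : 0 <= t * c + t ^+ 2 * (`|w| ^+ 2 / 2).
  have := gmin (g + t *: w); rewrite rpredD ?rpredZ// => /(_ isT).
  by rewrite /energy sqr_normD_scale dualDr dualZr /c; lra.
apply/eqP; rewrite -subr_eq0 -/c; apply/eqP.
(* The quadratic [t * c + t ^ 2 * k] is negative for small [t] of sign opposite
   to [c], unless [c = 0]; the shift by 1 covers [w = 0]. *)
set k := `|w| ^+ 2 / 2 in var; have k0 : 0 <= k by rewrite divr_ge0// sqr_ge0.
have := var (- c / (k + 1)); rewrite expr_div_n.
have -> : - c / (k + 1) * c + (- c) ^+ 2 / (k + 1) ^+ 2 * k =
          - (c ^+ 2 / (k + 1) ^+ 2) by field; lra.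
rewrite oppr_ge0 pmulr_lle0 ?invr_gt0 ?exprn_gt0//; last lra.
by move=> c2; apply/eqP; rewrite -sqrf_eq0 eq_le c2 sqr_ge0.
Qed.

End Hilbert.

(** * Nonlinear Galerkin equations *)

Section Galerkin.
Context {R : realType} {X : completeNormedModType R} (dot : {dot X for idfun}).
Context (dotE : forall x : X, `|x| = Num.sqrt (dot x x)).
Context (XH : submodClosed X) (XH_closed : closed [set` XH]).

(** Zarantonello's theorem for locally Lipschitz operators. Where [A] is
[l]-Lipschitz, [T v := v + tau J (F - A v)] satisfies
  |T v - T w|^2 <= (1 - 2 tau alpha + tau^2 l^2) |v - w|^2,
so it contracts with the factor [q = 1 - tau alpha / 2] once
[tau l^2 <= alpha]. As [|T 0| <= tau |F - A 0|], the ball of radius [rad] is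
mapped into itself as soon as [|F - A 0| <= alpha rad / 2], a condition free of
[tau] and [l]: the radius can thus be fixed first, then the Lipschitz constant
on the ball, and then the step size. *)
Lemma galerkin_solution (A : X -> dual X) (F : dual X) (alpha : R) (L : R -> R) :
    0 < alpha -> strongly_monotone A alpha -> locally_lipschitz A L ->
  exists2 u, u \in XH & forall w, w \in XH -> A u w = F w.
Proof.
move=> a0 A_mon A_lip.
have /choice[J JP] (phi : dual X) :
    exists g, g \in XH /\ forall w, w \in XH -> dot g w = phi w.
  by have [g ? ?] := riesz_representation dotE XH_closed phi; exists g.
have JXH phi : J phi \in XH by case: (JP phi).
have Jdot phi w : w \in XH -> dot (J phi) w = phi w by case: (JP phi) => _; apply.
(* The extra 1 keeps the radius positive when [A 0 = F]. *)
pose rad : R := 2 * `|F - A 0| / alpha + 1.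
have rad0 : 0 < rad by rewrite ltr_wpDl// divr_ge0 ?mulr_ge0// ltW.
(* The distance of two points of the ball can reach its diameter. *)
have rad2 : 0 < 2 * rad by rewrite mulr_gt0.
have [l0 lip] := A_lip _ rad2.
set l := L (2 * rad) in l0 lip.
(* The simpler [alpha / l ^ 2] would not give [tau * alpha <= 1], hence
   [0 <= q], when [X] is trivial and [l] bears no relation to [alpha]. *)
pose tau : R := alpha / (l + alpha) ^+ 2.
have la0 : 0 < l + alpha by rewrite addr_gt0.
have tau0 : 0 < tau by rewrite divr_gt0// exprn_gt0.
have tau_l : tau * l ^+ 2 <= alpha.
  rewrite /tau mulrAC ler_pdivrMr ?exprn_gt0// ler_pM2l//.
  by rewrite ler_pXn2r// ?nnegrE ?ltW//; lra.
have tau_a : tau * alpha <= 1.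
  rewrite /tau mulrAC ler_pdivrMr ?exprn_gt0// mul1r -expr2.
  by rewrite ler_pXn2r// ?nnegrE ?ltW//; lra.
pose T v := v + tau *: J (F - A v).
pose U := [set v | v \in XH /\ `|v| <= rad].
pose q : R := 1 - tau * alpha / 2.
have q0 : 0 <= q by rewrite /q; lra.
have T_contr v w : U v -> U w -> `|T v - T w| <= q * `|v - w|.
  move=> [vXH vr] [wXH wr].
  pose d := J (F - A v) - J (F - A w).
  have eXH : v - w \in XH by exact: submodB.
  have dXH : d \in XH by exact: submodB.
  have ddot x : x \in XH -> dot d x = - ((A v - A w) x).
    by move=> xXH; rewrite /d dotBl !Jdot// !dualB; ring.
  have vw2 : Num.max `|w| `|w - v| <= 2 * rad.
    rewrite ge_max; have := ler_normB w v; have := normr_ge0 v.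
    by move=> ? ?; apply/andP; split; lra.
  have d_le : `|d| <= l * `|v - w|.
    have [->|dn0] := eqVneq d 0; first by rewrite normr0 mulr_ge0// ltW.
    rewrite -(@ler_pM2r _ `|d|) ?normr_gt0// -expr2 -(dotxx dotE) ddot//.
    rewrite dualB opprB -dualB (distrC v); exact: lip.
  have -> : T v - T w = (v - w) + tau *: d.
    by rewrite /T /d scalerBr opprD addrACA.
  rewrite -(@ler_pXn2r _ 2)// ?nnegrE ?mulr_ge0// (sqr_normD_scale dotE).
  rewrite dotC ddot//.
  have := A_mon v w; set m := (A v - A w) _ => m_ge.
  have d2 : tau ^+ 2 * `|d| ^+ 2 <= tau * alpha * `|v - w| ^+ 2.
    have : `|d| ^+ 2 <= (l * `|v - w|) ^+ 2.
      by rewrite ler_pXn2r// nnegrE ?normr_ge0// mulr_ge0 ?normr_ge0// ltW.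
    rewrite -(ler_pM2l (exprn_gt0 2 tau0)) => /le_trans; apply.
    have -> : tau ^+ 2 * (l * `|v - w|) ^+ 2 = tau * (tau * l ^+ 2) * `|v - w| ^+ 2.
      by ring.
    by apply: ler_wpM2r; rewrite ?sqr_ge0// ler_pM2l.
  have m2 : tau * (alpha * `|v - w| ^+ 2) <= tau * m by rewrite ler_pM2l.
  have := sqr_ge0 (tau * alpha * `|v - w|); rewrite /q.
  lra.
have T_U v : U v -> U (T v).
  move=> Uv; have [vXH vr] := Uv; split; first by rewrite rpredD// rpredZ.
  have U0 : U 0 by split; [exact: rpred0|rewrite normr0 ltW].
  have J_le phi : `|J phi| <= `|phi|.
    have [->|j0] := eqVneq (J phi) 0; first by rewrite normr0.
    rewrite -(@ler_pM2r _ `|J phi|) ?normr_gt0// -expr2 -(dotxx dotE) Jdot//.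
    by rewrite (le_trans (ler_norm _))// dual_le.
  have TvT0 := T_contr v 0 Uv U0; rewrite subr0 in TvT0.
  have T0 : `|T 0| <= tau * `|F - A 0|.
    by rewrite /T add0r normrZ gtr0_norm// ler_pM2l.
  have tri : `|T v| <= `|T v - T 0| + `|T 0|.
    by rewrite -[in leLHS](subrK (T 0) (T v)) ler_normD.
  have qv : q * `|v| <= q * rad by rewrite ler_wpM2l.
  have -> : rad = q * rad + tau * (`|F - A 0| + alpha / 2).
    by rewrite /q /rad; field; rewrite gt_eqF.
  have ta0 : 0 < tau * alpha by rewrite mulr_gt0.
  lra.
have T_contraction : is_contraction (mkfun_fun T_U).
  exists (NngNum q0); split => [|[v w] [/= Uv Uw]]; last exact: T_contr.
  by rewrite /= /q ltrBlDr ltrDl divr_gt0// mulr_gt0.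
have U_closed : closed U.
  have -> : U = [set` XH] `&` (fun v : X => `|v|) @^-1` [set x | x <= rad] by [].
  apply: closedI; first exact: XH_closed.
  by apply: preimage_closed; [move=> x _; exact: norm_continuous|exact: closed_le].
have U_n0 : U !=set0 by exists 0; split; [exact: rpred0|rewrite normr0 ltW].
have [u [uXH _] uT] := banach_fixed_point T_contraction U_closed U_n0.
exists u => // w wXH; apply/esym/eqP; rewrite -subr_eq0 -dualB -Jdot//.
have /eqP := uT; rewrite /= /T -subr_eq0 opprD addrA subrr sub0r oppr_eq0.
by rewrite scaler_eq0 gt_eqF//= => /eqP ->; rewrite linear0l.
Qed.

End Galerkin.

(** * Derivative of the operator along lines *)

Section Derivative.
Context {R : realType} {X : normedModType R} (A : X -> dual X).
Context (A_diff : forall v, differentiable A v).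

Lemma cvg_dual_apply (T : Type) (G : set_system T) {FG : Filter G}
    (q : T -> dual X) (p : dual X) (w : X) :
  q @ G --> p -> q h w @[h --> G] --> p w.
Proof.
move=> /cvgrPdist_lt q_p; apply/cvgrPdist_lt => e e0.
have w0 : 0 < `|w| + 1 by rewrite ltr_wpDl.
have := q_p (e / (`|w| + 1)) (divr_gt0 e0 w0); apply: filterS => h.
rewrite ltr_pdivlMr// -dualB => /(le_lt_trans _); apply.
by rewrite (le_trans (dual_le _ _))// ler_wpM2l// lerDl.
Qed.

Lemma diff_quotient_cvg v z w :
  h^-1 * (A (v + h *: z) - A v) w @[h --> 0^'] --> 'd A v z w.
Proof.
rewrite -deriveE//.
have A_cvg : derivable A v z by exact: diff_derivable.
have -> : (fun h => h^-1 * (A (v + h *: z) - A v) w) =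
    (fun h => (h^-1 *: ((A \o shift v) (h *: z) - A v)) w).
  by apply/funext => h; rewrite dualZ /= [_ + v]addrC.
exact: cvg_dual_apply A_cvg.
Qed.

Lemma is_derive_line v z w (t : R) :
  is_derive t 1 (fun s => A (v + s *: z) w) ('d A (v + t *: z) z w).
Proof.
have := @diff_quotient_cvg (v + t *: z) z w.
have -> : (fun h => h^-1 * (A (v + t *: z + h *: z) - A (v + t *: z)) w) =
    (fun h => h^-1 *: (((fun s => A (v + s *: z) w) \o shift t) (h *: 1)
                       - A (v + t *: z) w)).
  apply/funext => h; rewrite dualB -addrA -scalerDl [t + h]addrC.
  by rewrite -[h in A (v + (h + t) *: z)]mulr1.
move=> A_cvg; apply: DeriveDef; first by apply/cvg_ex; eexists; exact: A_cvg.
exact: cvg_lim A_cvg.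
Qed.

(** Strong monotonicity between [v] and [v + h w] says that the difference
quotient in the direction [w], tested with [w], is at least [alpha |w|^2]; let
[h] tend to 0. *)
Lemma strongly_monotone_derivative alpha v w :
  strongly_monotone A alpha -> alpha * `|w| ^+ 2 <= 'd A v w w.
Proof.
move=> A_mon; have A_cvg := @diff_quotient_cvg v w w.
apply: (closed_cvg [set x | alpha * `|w| ^+ 2 <= x]) A_cvg; first exact: closed_ge.
near=> h => /=; have h0 : h != 0 by near: h; exact: nbhs_dnbhs_neq.
have := A_mon (v + h *: w) v; rewrite addrAC subrr add0r dualZr normrZ.
rewrite exprMn real_normK ?num_real// mulrCA.
have -> : h * (A (v + h *: w) - A v) w =
    h ^+ 2 * (h^-1 * (A (v + h *: w) - A v) w) by field.
by rewrite ler_pM2l// exprn_even_gt0.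
Unshelve. all: by end_near. Qed.

(** The one-sided bound suffices for residuals, whose norm is a supremum without
absolute values. It needs no integral: the function [h] of the proof, the
remainder minus its bound, is nonincreasing because its derivative is
nonpositive by assumption. *)
Lemma taylor_remainder v z w (K d : R) : 0 <= d ->
    (forall t : R, 0 < t < d -> 'd A v z w - 'd A (v + t *: z) z w <= K * t) ->
  A v w + d * 'd A v z w - A (v + d *: z) w <= K * d ^+ 2 / 2.
Proof.
move=> d0 dA_le; set D := 'd A v z w.
pose h t := t * D - A (v + t *: z) w - K / 2 * (t * t).
have dh (t : R) : is_derive t 1 h (D - 'd A (v + t *: z) z w - K * t).
  have dA := @is_derive_line v z w t.
  apply: is_derive_eq; rewrite /GRing.scale/=; lra.
have h_decr : h d <= h 0.
  apply: (@ler0_derive1_nincr _ h 0 d) => //.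
  - move=> t; rewrite in_itv/= derive1E => /dA_le; have [_ ->] := dh t.
    by rewrite -/D; lra.
  - apply: continuous_subspaceT => t; apply: differentiable_continuous.
    by apply/derivable1_diffP; case: (dh t).
move: h_decr; rewrite /h scale0r addr0; lra.
Qed.

Lemma opnorm_diffB u v z w :
  `|('d A u z - 'd A v z) w| <=
    opnorm (fun x => 'd A u x - 'd A v x) * `|z| * `|w|.
Proof.
apply: le_trans (dual_le _ _) _; apply: ler_wpM2r => //.
apply: (@opnormP _ _ _ (fun x => 'd A u x - 'd A v x)).
  move=> a x y; rewrite (linearP ('d A u)) (linearP ('d A v)).
  by rewrite scalerBr opprD addrACA.
by move=> x; apply: cvgB; exact: diff_continuous.
Qed.

End Derivative.

(** * A priori bounds for the Galerkin solution *)

Section APriori.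
Context {R : realType} {X : normedModType R} (XH : submodClosed X).
Context (A : X -> dual X) (F : dual X) (alpha : R).
Context (alpha_gt0 : 0 < alpha) (A_mon : strongly_monotone A alpha).

(** Both a priori bounds in terms of the residual, for the error and for the
Newton direction, are instances: a functional in the discrete dual norm controls
the vector on which it is coercive. *)
Lemma coercive_le_subdual_norm (phi : dual X) x c : x \in XH ->
  c * `|x| ^+ 2 <= phi x -> c * `|x| <= subdual_norm XH phi.
Proof.
move=> xXH; have [->|x0] := eqVneq x 0.
  by rewrite normr0 mulr0 subdual_norm_ge0.
rewrite expr2 mulrA => /le_trans -/(_ _ (subdual_normP phi xXH)).
by rewrite ler_pM2r ?normr_gt0.
Qed.

Lemma dist_galerkin_le_residual u v : u \in XH -> v \in XH ->
    (forall w, w \in XH -> A u w = F w) ->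
  alpha * `|v - u| <= residual A F XH v.
Proof.
move=> uXH vXH uP; have uvXH : u - v \in XH by exact: submodB.
rewrite distrC; apply: (@coercive_le_subdual_norm (F - A v) _ alpha uvXH).
by apply: le_trans (A_mon u v) _; rewrite !dualB uP.
Qed.

Lemma norm_galerkin_le u : u \in XH -> (forall w, w \in XH -> A u w = F w) ->
  `|u| <= alpha^-1 * `|F - A 0|.
Proof.
move=> uXH uP; rewrite ler_pdivlMl//.
apply: le_trans (_ : _ <= residual A F XH 0) _.
  by rewrite -[in leLHS](subr0 u) distrC dist_galerkin_le_residual ?rpred0.
by apply: subdual_norm_le => // w _; exact: le_trans (ler_norm _) (dual_le _ _).
Qed.

Lemma residual_le_dist_galerkin u v l : 0 <= l ->
    (forall w, w \in XH -> A u w = F w) ->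
    (forall w, w \in XH -> (A u - A v) w <= l * `|w|) ->
  residual A F XH v <= l.
Proof.
move=> l0 uP Aul; apply: subdual_norm_le => // w wXH.
by rewrite dualB -uP// -dualB; exact: Aul.
Qed.

End APriori.

(** * The damped Newton step *)

Section Newton.
Context {R : realType} {X : completeNormedModType R} (dot : {dot X for idfun}).
Context (dotE : forall x : X, `|x| = Num.sqrt (dot x x)).
Context (XH : submodClosed X) (XH_closed : closed [set` XH]).
Context (A : X -> dual X) (F : dual X) (A_diff : forall v, differentiable A v).

(** The bounded coercive operator ['d A v] is strongly monotone and globally
Lipschitz, so the Lax-Milgram theorem is a case of [galerkin_solution]. *)
Lemma newton_directionP v alpha (rho := newton_direction A F XH v) :
    0 < alpha -> (forall w, alpha * `|w| ^+ 2 <= 'd A v w w) ->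
  rho \in XH /\ forall w, w \in XH -> 'd A v rho w = (F - A v) w.
Proof.
move=> alpha_gt0 dA_coer.
have dA_mon : strongly_monotone ('d A v) alpha.
  by move=> x y; rewrite -raddfB.
have dA_lip : locally_lipschitz ('d A v) (fun=> opnorm ('d A v) + 1).
  (* Adding 1 makes the constant positive even if ['d A v] vanishes. *)
  move=> theta _; split=> [|x y phi _]; first by rewrite ltr_wpDl// opnorm_ge0.
  rewrite -(raddfB ('d A v)) (le_trans (ler_norm _))// (le_trans (dual_le _ _))//.
  apply: ler_wpM2r => //; apply: le_trans (_ : _ <= opnorm ('d A v) * _) _.
    by apply: opnormP; [exact: linearP|exact: diff_continuous].
  by apply: ler_wpM2r => //; rewrite lerDl.
have [z zXH zP] :=
  galerkin_solution dotE XH_closed (F - A v) alpha_gt0 dA_mon dA_lip.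
exact: (@getPex _ [set z | z \in XH /\
  forall w, w \in XH -> 'd A v z w = (F - A v) w] (ex_intro _ z (conj zXH zP))).
Qed.

(** By the equation for [rho], the linear part of [A (v + delta rho) - A v]
cancels the fraction [delta] of the residual; the rest is the Taylor
remainder. *)
Lemma residual_newton_step v K delta (rho := newton_direction A F XH v) :
    rho \in XH -> (forall w, w \in XH -> 'd A v rho w = (F - A v) w) ->
    0 <= K -> 0 <= delta <= 1 ->
    (forall t, 0 < t < delta ->
      opnorm (fun x => 'd A v x - 'd A (v + t *: rho) x) <= K * (t * `|rho|)) ->
  residual A F XH (newton_step A F XH delta v) <=
    (1 - delta) * residual A F XH v + K * `|rho| ^+ 2 * delta ^+ 2 / 2.
Proof.
move=> rXH rP K0 /andP[d0 d1] dA_le.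
apply: subdual_norm_le => [|w wXH].
  apply: addr_ge0; first by rewrite mulr_ge0 ?subr_ge0 ?subdual_norm_ge0.
  by rewrite divr_ge0// !mulr_ge0 ?sqr_ge0.
have rem := @taylor_remainder _ _ _ A_diff v rho w (K * `|rho| ^+ 2 * `|w|) delta d0.
have {}rem : A v w + delta * (F - A v) w - A (v + delta *: rho) w <=
    K * `|rho| ^+ 2 * `|w| * delta ^+ 2 / 2.
  rewrite -rP//; apply: rem => t t0d; rewrite -dualB.
  apply: le_trans (ler_norm _) _; apply: le_trans (opnorm_diffB A_diff _ _ _ _) _.
  rewrite [leRHS](_ : _ = K * (t * `|rho|) * `|rho| * `|w|); last by ring.
  by do 2!apply: ler_wpM2r => //; exact: dA_le.
have : (1 - delta) * (F - A v) w <= (1 - delta) * (residual A F XH v * `|w|).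
  by apply: ler_wpM2l; [rewrite subr_ge0|exact: subdual_normP].
move: rem; rewrite /newton_step -/rho !dualB; lra.
Qed.

End Newton.

(** * The reduction factor *)

(** For [delta_opt < 1] the vertex of the parabola lies in the interval and
completing the square gives the claims; otherwise [C <= 1/2] and the parabola
decreases on the whole interval. In the second case [r_opt = C], which is
[1 - delta_opt / 2] only for [C = 1/2]. *)
Lemma optimal_damping (R : realFieldType) (C : R) (C_gt0 : 0 < C)
    (r := fun delta => 1 - delta + C * delta ^+ 2)
    (delta_opt := Num.min (2 * C)^-1 1)
    (r_opt := if delta_opt < 1 then 1 - delta_opt / 2 else C) :
  [/\ 0 < delta_opt <= 1,
      forall delta, 0 < delta <= 1 -> r delta_opt <= r delta,
      r delta_opt = r_opt,
      0 < r_opt < 1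
    & forall delta, 0 < delta <= delta_opt ->
        r delta < 1 /\ (2^-1 <= C -> r_opt = 1 - delta_opt / 2)].
Proof.
have C2_gt0 : 0 < (2 * C)^-1 by rewrite invr_gt0 mulr_gt0.
have C2E : C * (2 * C)^-1 = 2^-1 by field; rewrite gt_eqF.
rewrite /r_opt /delta_opt /r; move: C2_gt0 C2E; set d := (2 * C)^-1 => d0 dE.
case: (ltP d 1) => d1; rewrite ?ltxx ?d1.
- have rE x : 1 - x + C * x ^+ 2 = 1 - d / 2 + C * (x - d) ^+ 2.
    have -> : C * (x - d) ^+ 2 = C * x ^+ 2 - 2 * (C * d) * x + C * d * d by ring.
    by rewrite dE; lra.
  split; first by rewrite d0 ltW.
  + by move=> x _; rewrite !rE subrr expr0n/= mulr0 lerD2l mulr_ge0 ?sqr_ge0// ltW.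
  + by rewrite rE subrr expr0n/= mulr0 addr0.
  + by apply/andP; split; lra.
  + move=> x /andP[x0 xd]; split=> //.
    have : C * x * x <= 2^-1 * x by rewrite ler_pM2r// -dE ler_pM2l.
    by rewrite expr2 mulrA; lra.
- have C12 : C <= 2^-1 by rewrite -dE -[leLHS]mulr1 ler_pM2l.
  split; rewrite ?ltr01 ?lexx//.
  + move=> x /andP[x0 x1]; rewrite -subr_ge0.
    have -> : 1 - x + C * x ^+ 2 - (1 - 1 + C * 1 ^+ 2) =
              (1 - x) * (1 - C * (x + 1)) by ring.
    apply: mulr_ge0; first by rewrite subr_ge0.
    have : C * (x + 1) <= 2^-1 * (x + 1) by rewrite ler_pM2r//; lra.
    lra.
  + by rewrite subrr add0r expr1n mulr1.
  + by apply/andP; split; lra.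
  + move=> x /andP[x0 x1]; split=> [|?]; last lra.
    have : C * x * x <= 2^-1 * x.
      by rewrite ler_pM2r// -[leRHS]mulr1 ler_pM// ltW.
    by rewrite expr2 mulrA; lra.
Qed.

(** * Reduction of the residual on the level set *)

Theorem theorem4 (R : realType)
    (* a real Hilbert space *)
    (X : completeNormedModType R) (dot : {dot X for idfun})
    (dotE : forall x : X, `|x| = Num.sqrt (dot x x))
    (A : X -> dual X) (F : dual X) (XH : submodClosed X)
    (alpha beta c0 : R) (L M : R -> R) (u0 : X)
    (A_diff : forall v, differentiable A v)
    (alpha_gt0 : 0 < alpha) (A_mon : strongly_monotone A alpha)
    (A_lip : locally_lipschitz A L)
    (beta_gt0 : 0 < beta) (dA_coer : uniformly_coercive_derivative A beta)
    (dA_lip : locally_lipschitz_derivative A M)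
    (A0_neq_F : A 0 <> F)
    (XH_closed : closed [set` XH])
    (c0_gt1 : 1 < c0) (u0_XH : u0 \in XH) :
  let B0 := alpha^-1 * `|F - A 0| in
  `|u0| <= c0 * B0 ->
  let L0 := L ((1 + c0) * B0) in
  let Bbar0 := alpha^-1 * L0 * ((1 + c0) * B0) + B0 in
  let C0 := M Bbar0 * L0 * ((1 + c0) * B0) / (2 * beta ^+ 2) in
  let r delta := 1 - delta + C0 * delta ^+ 2 in
  let delta_opt := Num.min (2 * C0)^-1 1 in
  let r_opt := if delta_opt < 1 then 1 - delta_opt / 2 else C0 in
  let LH := level_set A F XH u0 in
  let Phi := newton_step A F XH in
  let res := residual A F XH in
  [/\ C0 <= alpha * M Bbar0 * Bbar0 / (2 * beta ^+ 2),
      (* the reduction is strict unless v already solves the discrete problem,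
         in which case both sides vanish *)
      forall delta v, 0 < delta <= 1 -> LH v ->
        res (Phi delta v) <= r delta * res v /\
        (0 < res v -> res (Phi delta v) < r delta * res v),
      [/\ 0 < delta_opt <= 1,
          forall delta, 0 < delta <= 1 -> r delta_opt <= r delta,
          r delta_opt = r_opt & 0 < r_opt < 1],
      forall v, LH v ->
        res (Phi delta_opt v) <= r_opt * res v /\
        (0 < res v -> res (Phi delta_opt v) < r_opt * res v)
    & forall delta, 0 < delta <= delta_opt ->
        [/\ r_opt <= r delta < 1,
            (* r_opt = C0 < 1 - delta_opt / 2 when C0 < 1/2 *)
            2^-1 <= C0 -> 1 - delta_opt / 2 <= r delta
          & forall v, LH v -> LH (Phi delta v)]].
Proof.
move=> B0 u0_le L0 Bbar0 C0 r delta_opt r_opt LH Phi res.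
have B0_gt0 : 0 < B0.
  rewrite mulr_gt0 ?invr_gt0// normr_gt0 subr_eq0.
  by apply/eqP => FA; apply: A0_neq_F.
have rad_gt0 : 0 < (1 + c0) * B0 by rewrite mulr_gt0//; lra.
have [L0_gt0 L0_lip] := A_lip _ rad_gt0; rewrite -/L0 in L0_gt0 L0_lip.
pose l0 := L0 * ((1 + c0) * B0).
have l0_gt0 : 0 < l0 by rewrite mulr_gt0.
have BbarE : alpha * Bbar0 = l0 + alpha * B0.
  by rewrite /Bbar0 /l0; field; rewrite gt_eqF.
have Bbar_gt0 : 0 < Bbar0.
  by rewrite -(pmulr_rgt0 _ alpha_gt0) BbarE addr_gt0// mulr_gt0.
have [M0_gt0 M0_lip] := dA_lip.1 _ Bbar_gt0.
have C0E : C0 = M Bbar0 * l0 / (2 * beta ^+ 2) by rewrite /C0 /l0 !mulrA.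
have beta2_gt0 : 0 < 2 * beta ^+ 2 by rewrite mulr_gt0// exprn_gt0.
have C0_gt0 : 0 < C0 by rewrite C0E divr_gt0// mulr_gt0.
have [u uXH uP] := galerkin_solution dotE XH_closed F alpha_gt0 A_mon A_lip.
have u_le : `|u| <= B0 by exact: (norm_galerkin_le alpha_gt0 A_mon uXH uP).
have res_u0 : res u0 <= l0.
  have u_u0 : `|u - u0| <= (1 + c0) * B0.
    by rewrite (le_trans (ler_normB _ _))// mulrDl mul1r lerD.
  apply: residual_le_dist_galerkin uP _; first exact: ltW.
  move=> w wXH; apply: le_trans (L0_lip u u0 w _) _.
    rewrite ge_max u_u0 andbT (le_trans u_le)// ler_peMl//; [exact: ltW|lra].
  by rewrite ler_wpM2r// ler_pM2l.
have dA_alpha v w : alpha * `|w| ^+ 2 <= 'd A v w w.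
  exact: (strongly_monotone_derivative A_diff).
have step delta v : 0 < delta <= 1 -> LH v ->
    res (Phi delta v) <= r delta * res v /\
    (0 < res v -> res (Phi delta v) < r delta * res v).
  move=> /andP[d0 d1] [vXH v_lt].
  have res_v0 : 0 <= res v by exact: subdual_norm_ge0.
  have res_v : res v < l0 by exact: lt_le_trans v_lt res_u0.
  have [rXH rP] := newton_directionP dotE XH_closed F A_diff alpha_gt0 (dA_alpha v).
  set rho := newton_direction A F XH v in rXH rP.
  (* [alpha * Bbar0] is the sum of the bounds for the error [v - u] and for [u],
     each multiplied by [alpha]. *)
  have v_le : `|v| <= Bbar0.
    rewrite -(ler_pM2l alpha_gt0) BbarE.
    have := dist_galerkin_le_residual A_mon uXH vXH uP; rewrite -/res.
    have : alpha * `|v| <= alpha * `|v - u| + alpha * `|u|.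
      by rewrite -mulrDr ler_pM2l// -[in leLHS](subrK u v) ler_normD.
    have : alpha * `|u| <= alpha * B0 by rewrite ler_pM2l.
    lra.
  have rho_le c : (forall w, c * `|w| ^+ 2 <= 'd A v w w) -> c * `|rho| <= res v.
    move=> c_coer; apply: (@coercive_le_subdual_norm _ _ XH (F - A v) _ c rXH).
    by rewrite -rP.
  have rho_alpha : `|rho| <= Bbar0.
    rewrite -(ler_pM2l alpha_gt0) BbarE (le_trans (rho_le _ (dA_alpha v)))//.
    by rewrite (le_trans (ltW res_v))// lerDl mulr_ge0// ltW.
  have rho_beta := rho_le beta (dA_coer v).
  have := @residual_newton_step _ _ XH A F A_diff v (M Bbar0) delta rXH rP.
  rewrite -/rho ltW// ltW//= d1 => /(_ isT isT).
  have dA_le t : 0 < t < delta ->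
      opnorm (fun x => 'd A v x - 'd A (v + t *: rho) x)
      <= M Bbar0 * (t * `|rho|).
    move=> /andP[t0 td].
    have vt : `|v - (v + t *: rho)| = t * `|rho|.
      by rewrite opprD addrA subrr add0r normrN normrZ gtr0_norm.
    rewrite -vt; apply: M0_lip; rewrite ge_max v_le vt/=.
    by rewrite (le_trans _ rho_alpha)// ler_piMl//; lra.
  move=> /(_ dA_le); rewrite -/res -/(Phi delta v) => res_le.
  have quad : M Bbar0 * `|rho| ^+ 2 * delta ^+ 2 / 2 <=
      M Bbar0 / (2 * beta ^+ 2) * delta ^+ 2 * res v * res v.
    have -> : M Bbar0 * `|rho| ^+ 2 * delta ^+ 2 / 2 =
        M Bbar0 / (2 * beta ^+ 2) * delta ^+ 2 * ((beta * `|rho|) ^+ 2).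
      by field; rewrite gt_eqF.
    rewrite -[leRHS]mulrA -expr2 ler_pM2l; last by rewrite mulr_gt0 ?divr_gt0 ?exprn_gt0.
    by rewrite ler_pXn2r// nnegrE ?mulr_ge0// ltW.
  have rE : r delta * res v = (1 - delta) * res v +
      M Bbar0 / (2 * beta ^+ 2) * delta ^+ 2 * res v * l0.
    by rewrite /r C0E; ring.
  have k0 : 0 < M Bbar0 / (2 * beta ^+ 2) * delta ^+ 2.
    by rewrite mulr_gt0 ?divr_gt0 ?exprn_gt0.
  split=> [|res_v_gt0]; rewrite rE.
    apply: le_trans res_le _; rewrite lerD2l (le_trans quad)//.
    by rewrite ler_wpM2l ?(ltW res_v)// mulr_ge0// ltW.
  apply: le_lt_trans res_le _; rewrite ltrD2l (le_lt_trans quad)//.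
  by rewrite ltr_pM2l// mulr_gt0.
have [d_opt r_min r_optE r_opt01 small] := optimal_damping C0_gt0.
rewrite -/delta_opt -/r_opt in d_opt r_min r_optE r_opt01 small.
split=> //.
- rewrite C0E ler_pM2r ?invr_gt0// [alpha * _]mulrC -mulrA ler_pM2l//.
  by rewrite BbarE lerDl mulr_ge0// ltW.
- by move=> v v_LH; rewrite -r_optE; exact: step.
- move=> delta d_le; have [r_lt1 r_optP] := small _ d_le.
  have d01 : 0 < delta <= 1.
    have /andP[d0 dd] := d_le; have /andP[_ d1] := d_opt.
    by rewrite d0 (le_trans dd).
  have r_ge : r_opt <= r delta by rewrite -r_optE; exact: r_min.
  split; first by rewrite r_ge.
    by move=> /r_optP <-.
  move=> v v_LH; have [vXH v_lt] := v_LH; split.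
    have [rXH _] := newton_directionP dotE XH_closed F A_diff alpha_gt0 (dA_alpha v).
    by rewrite rpredD// rpredZ.
  apply: le_lt_trans (step _ _ d01 v_LH).1 _; apply: le_lt_trans v_lt.
  by rewrite ler_piMl ?subdual_norm_ge0// ltW.
Qed.
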